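(* Let $R$ be a Noetherian normal domain with $\dim R\geq 2$ and $N$ an $R$-module of rank $s$ with finite free presentation $R^{\beta_1}\xrightarrow{\psi}R^{\beta_0}\to N\to 0$. (a) If $N$ is torsionfree, then $\operatorname{height}(I_{\beta_0-s}(\psi))\geq 2$. (b) Suppose that there exists an exact sequence $$0\to R^{s}\xrightarrow{\varphi}M\to N\to 0,$$ where $M$ is a torsionfree $R$-module of finite projective dimension. If $\operatorname{height}(I_{\beta_0-s}(\psi))\geq 2$, then $N$ is torsionfree.
   Context: A finitely generated $R$-module $N$ is torsionfree if $N\to\mathrm{Q}(R)\otimes_R N$ is injective, where $\mathrm{Q}(R)$ is the total ring of fractions. $I_t(\psi)$ denotes the ideal generated by the $t$-minors of a matrix representing $\psi$, with $I_t(\psi)=R$ for $t\leq 0$. The unit ideal has height $\infty$. *)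

(* Defs.v *)
From HB Require Import structures.
From mathcomp Require Import all_boot all_order all_algebra.
From mathcomp Require Import generic_quotient.
From mathcomp Require Import boolp classical_sets.
From mathcomp Require Import ring.

Set Implicit Arguments.
Unset Strict Implicit.
Unset Printing Implicit Defensive.

Import GRing.Theory.
Local Open Scope ring_scope.
Local Open Scope quotient_scope.
Local Open Scope classical_set_scope.

Definition is_ideal (R : comNzRingType) (I : set R) : Prop :=
  [/\ I 0, forall x y, I x -> I y -> I (x + y) & forall a x, I x -> I (a * x)].

Definition ideal_gen (R : comNzRingType) (A : set R) : set R :=
  smallest (@is_ideal R) A.

Definition is_prime_ideal (R : comNzRingType) (P : set R) : Prop :=
  [/\ is_ideal P, ~ P 1 & forall x y, P (x * y) -> P x \/ P y].

Definition noetherian (R : comNzRingType) : Prop :=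
  forall I : set R, is_ideal I ->
    exists s : seq R, I = ideal_gen [set x | x \in s].

Definition normal_domain (R : idomainType) : Prop :=
  forall x : {fraction R}, integralOver (@FracField.tofrac R) x ->
    exists a : R, x = FracField.tofrac a.

(* P 0 < P 1 < ... < P m; the sets P i with m < i are irrelevant. *)
Definition prime_chain (R : comNzRingType) (m : nat) (P : nat -> set R) : Prop :=
  (forall i, (i <= m)%N -> is_prime_ideal (P i)) /\
  (forall i, (i < m)%N -> P i `<` P i.+1).

(* Dimension and height take values in the naturals extended by infinity, so
   only their comparison with a natural number is defined. A supremum of chain
   lengths is at least n when some chain has length at least n. *)
Definition dim_ge (R : comNzRingType) (n : nat) : Prop :=
  exists (m : nat) (P : nat -> set R), (n <= m)%N /\ prime_chain m P.

Definition prime_height_ge (R : comNzRingType) (p : set R) (n : nat) : Prop :=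
  exists (m : nat) (P : nat -> set R),
    [/\ (n <= m)%N, prime_chain m P & P m = p].

(* The height of I is the infimum of the heights of the primes containing I;
   for the unit ideal there are none, which gives height infinity. *)
Definition height_ge (R : comNzRingType) (I : set R) (n : nat) : Prop :=
  forall p : set R, is_prime_ideal p -> I `<=` p -> prime_height_ge p n.

Definition is_minor (R : comNzRingType) (m n k : nat) (A : 'M[R]_(m, n))
    (x : R) : Prop :=
  exists (f : 'I_k -> 'I_m) (g : 'I_k -> 'I_n),
    [/\ {homo f : i j / (i < j)%N}, {homo g : i j / (i < j)%N}
      & x = \det (mxsub f g A)].

(* For t = 0 the only minor is the determinant 1 of the empty matrix, so the
   ideal is R, as for t < 0. *)
Definition minor_ideal (R : comNzRingType) (m n : nat) (t : int)
    (A : 'M[R]_(m, n)) : set R :=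
  match t with
  | Posz k => ideal_gen [set x | is_minor k A x]
  | Negz _ => setT
  end.

Definition is_surjective (A B : Type) (f : A -> B) : Prop := forall b, exists a, f a = b.

Definition exact_at (A B : Type) (C : zmodType) (f : A -> B) (g : B -> C) : Prop :=
  forall b, g b = 0 <-> exists a, f a = b.

Definition projective (R : nzRingType) (P : lmodType R) : Prop :=
  forall (A B : lmodType R) (g : {linear A -> B}) (f : {linear P -> B}),
    is_surjective g -> exists h : {linear P -> A}, forall x, g (h x) = f x.

(* A projective resolution ... -> P 1 -> P 0 -> M -> 0 with P i = 0 for i > n. *)
Definition finite_pdim (R : nzRingType) (M : lmodType R) : Prop :=
  exists (n : nat) (P : nat -> lmodType R)
    (d : forall i, {linear P i.+1 -> P i}) (e : {linear P 0%N -> M}),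
    [/\ forall i, projective (P i),
        forall i (x : P i), (n < i)%N -> x = 0,
        is_surjective e,
        exact_at (d 0%N) e
      & forall i, exact_at (d i.+1) (d i)].

(* Q(R) (x)_R N for a domain R, realised as the module of fractions n / d with
   d <> 0; lemma [frac_tensorP] is the universal property of the tensor
   product. *)
Section FracModule.
Variables (R : idomainType) (N : lmodType R).

Local Notation K := {fraction R}.
Local Notation "x %:F" := (@FracField.tofrac R x).
Local Notation denom := {d : R | d != 0}.

Definition fracmod_eq (x y : N * denom) : bool :=
  `[< exists2 u : R, u != 0 &
        u *: (val y.2 *: x.1) = u *: (val x.2 *: y.1) >].

Lemma fracmod_eq_refl : reflexive fracmod_eq.
Proof. by move=> x; apply/asboolP; exists 1; rewrite ?oner_neq0. Qed.

Lemma fracmod_eq_sym : symmetric fracmod_eq.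
Proof.
by move=> x y; apply/asboolP/asboolP => -[u u0 e]; exists u.
Qed.

Lemma fracmod_eq_trans : transitive fracmod_eq.
Proof.
move=> y x z /asboolP[u u0 exy] /asboolP[v v0 eyz]; apply/asboolP.
exists (u * v * val y.2); first by rewrite !mulf_neq0 // (valP y.2).
transitivity ((v * val z.2) *: (u *: (val y.2 *: x.1))).
  by rewrite !scalerA; congr (_ *: _) => /=; ring.
rewrite exy.
transitivity ((u * val x.2) *: (v *: (val z.2 *: y.1))).
  by rewrite !scalerA; congr (_ *: _) => /=; ring.
by rewrite eyz !scalerA; congr (_ *: _) => /=; ring.
Qed.

Canonical fracmod_equiv :=
  EquivRel fracmod_eq fracmod_eq_refl fracmod_eq_sym fracmod_eq_trans.

Definition fracmod := {eq_quot fracmod_eq}.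
HB.instance Definition _ : EqQuotient _ fracmod_eq fracmod :=
  EqQuotient.on fracmod.
HB.instance Definition _ := Choice.on fracmod.

Definition one_denom : denom := Sub 1 (oner_neq0 R).
Definition mul_denom (d e : denom) : denom :=
  Sub (val d * val e) (mulf_neq0 (valP d) (valP e)).

Definition fracmod_mk (n : N) (d : denom) : fracmod := \pi_fracmod (n, d).

Local Notation "n /: d" := (fracmod_mk n d) (at level 40).

Lemma fracmod_mkP n d n' d' : n /: d = n' /: d' <->
  exists2 u : R, u != 0 & u *: (val d' *: n) = u *: (val d *: n').
Proof.
split=> [/eqmodP/asboolP //|e].
by apply/eqmodP/asboolP.
Qed.

Lemma fracmod_mk_eq n d n' d' :
  val d' *: n = val d *: n' -> n /: d = n' /: d'.
Proof. by move=> e; apply/fracmod_mkP; exists 1; rewrite ?oner_neq0 ?e. Qed.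

Lemma fracmod_ind (P : fracmod -> Prop) : (forall n d, P (n /: d)) -> forall x, P x.
Proof. by move=> h; elim/quotW => -[n d]; apply: h. Qed.

Definition fracmod_add (x y : fracmod) : fracmod :=
  (val (repr y).2 *: (repr x).1 + val (repr x).2 *: (repr y).1) /:
    mul_denom (repr x).2 (repr y).2.

Definition fracmod_opp (x : fracmod) : fracmod := (- (repr x).1) /: (repr x).2.

Definition fracmod_scale (a : K) (x : fracmod) : fracmod :=
  (\n_(repr a) *: (repr x).1) /:
    mul_denom (Sub (\d_(repr a)) (denom_ratioP (repr a))) (repr x).2.

Lemma repr_fracmod x : (repr x).1 /: (repr x).2 = x.
Proof. by rewrite -[RHS]reprK /fracmod_mk; case: (repr x). Qed.

Lemma repr_fracmod_mkP n d : exists2 u : R, u != 0 &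
  u *: (val d *: (repr (n /: d)).1) = u *: (val (repr (n /: d)).2 *: n).
Proof. by apply/fracmod_mkP; rewrite repr_fracmod. Qed.

Lemma fracmod_addE n d m e : fracmod_add (n /: d) (m /: e) =
  (val e *: n + val d *: m) /: mul_denom d e.
Proof.
rewrite /fracmod_add.
have [u u0 eu] := repr_fracmod_mkP n d.
have [v v0 ev] := repr_fracmod_mkP m e.
move: (repr (n /: d)) (repr (m /: e)) eu ev => [n' d'] [m' e'] /= eu ev.
apply/fracmod_mkP; exists (u * v); first exact: mulf_neq0.
rewrite /= !scalerDr; congr (_ + _).
  transitivity ((v * val e * val e') *: (u *: (val d *: n'))).
    by rewrite !scalerA; congr (_ *: _) => /=; ring.
  by rewrite eu !scalerA; congr (_ *: _) => /=; ring.
transitivity ((u * val d * val d') *: (v *: (val e *: m'))).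
  by rewrite !scalerA; congr (_ *: _) => /=; ring.
by rewrite ev !scalerA; congr (_ *: _) => /=; ring.
Qed.

Lemma fracmod_oppE n d : fracmod_opp (n /: d) = (- n) /: d.
Proof.
rewrite /fracmod_opp; have [u u0 eu] := repr_fracmod_mkP n d.
by apply/fracmod_mkP; exists u; rewrite // !scalerN eu.
Qed.

Lemma repr_fraction (a : K) : a * (\d_(repr a))%:F = (\n_(repr a))%:F.
Proof.
rewrite -{1}[a]reprK; case: (repr a) => -[p q] /= q0.
unlock FracField.tofrac; rewrite -[LHS]FracField.pi_mul.
apply/eqmodP; rewrite /= FracField.equivfE /FracField.mulf.
by rewrite !numden_Ratio ?mulr1 ?oner_neq0 // mulrC.
Qed.

Lemma fracmod_scaleE (a : K) (p : R) (q : denom) n d :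
  a * (val q)%:F = p%:F ->
  fracmod_scale a (n /: d) = (p *: n) /: mul_denom q d.
Proof.
move=> apq; rewrite /fracmod_scale.
have [u u0 eu] := repr_fracmod_mkP n d; move: (repr (n /: d)) eu => [n' d'] /= eu.
have eq : \n_(repr a) * val q = p * \d_(repr a).
  by apply/eqP; rewrite -tofrac_eq !tofracM -repr_fraction -apq mulrAC.
apply/fracmod_mkP; exists u => //=.
transitivity ((\n_(repr a) * val q) *: (u *: (val d *: n'))).
  by rewrite !scalerA; congr (_ *: _) => /=; ring.
by rewrite eq eu !scalerA; congr (_ *: _) => /=; ring.
Qed.

Lemma fraction_ratio (a : K) :
  exists (p : R) (q : denom), a * (val q)%:F = p%:F.
Proof.
exists (\n_(repr a)), (Sub (\d_(repr a)) (denom_ratioP (repr a))).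
exact: repr_fraction.
Qed.

Lemma fracmod_addA : associative fracmod_add.
Proof.
elim/fracmod_ind=> n d; elim/fracmod_ind=> m e; elim/fracmod_ind=> l f.
rewrite !fracmod_addE; apply: fracmod_mk_eq => /=.
by rewrite !scalerDr !scalerA addrA; congr (_ + _ + _); congr (_ *: _) => /=; ring.
Qed.

Lemma fracmod_addC : commutative fracmod_add.
Proof.
elim/fracmod_ind=> n d; elim/fracmod_ind=> m e.
rewrite !fracmod_addE; apply: fracmod_mk_eq => /=.
by rewrite addrC mulrC.
Qed.

Lemma fracmod_add0 : left_id (0 /: one_denom) fracmod_add.
Proof.
elim/fracmod_ind=> n d; rewrite fracmod_addE; apply: fracmod_mk_eq => /=.
by rewrite scaler0 add0r scale1r mul1r.
Qed.

Lemma fracmod_addN : left_inverse (0 /: one_denom) fracmod_opp fracmod_add.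
Proof.
elim/fracmod_ind=> n d; rewrite fracmod_oppE fracmod_addE.
by apply: fracmod_mk_eq => /=; rewrite scalerN addNr !scaler0.
Qed.

HB.instance Definition _ := GRing.isZmodule.Build fracmod
  fracmod_addA fracmod_addC fracmod_add0 fracmod_addN.

Lemma fracmod_scaleA a b x :
  fracmod_scale a (fracmod_scale b x) = fracmod_scale (a * b) x.
Proof.
elim/fracmod_ind: x => n d.
have [p [q apq]] := fraction_ratio a; have [r [s brs]] := fraction_ratio b.
rewrite (fracmod_scaleE _ _ brs) (fracmod_scaleE _ _ apq).
rewrite (@fracmod_scaleE _ (p * r) (mul_denom q s)).
  by apply: fracmod_mk_eq; rewrite /= !scalerA; congr (_ *: _) => /=; ring.
by rewrite /= !tofracM mulrACA apq brs.
Qed.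

Lemma fracmod_scale1 : left_id 1 fracmod_scale.
Proof.
elim/fracmod_ind=> n d; rewrite (@fracmod_scaleE _ 1 one_denom) ?mulr1 //.
by apply: fracmod_mk_eq; rewrite /= mul1r scale1r.
Qed.

Lemma fracmod_scaleDr : right_distributive fracmod_scale +%R.
Proof.
move=> a; elim/fracmod_ind=> n d; elim/fracmod_ind=> m e.
have [p [q apq]] := fraction_ratio a.
rewrite [_ /: d + _]fracmod_addE !(fracmod_scaleE _ _ apq).
rewrite [RHS]fracmod_addE; apply: fracmod_mk_eq => /=.
by rewrite !scalerDr !scalerA; congr (_ *: _ + _ *: _) => /=; ring.
Qed.

Lemma fracmod_scaleDl x : {morph fracmod_scale^~ x : a b / a + b}.
Proof.
elim/fracmod_ind: x => n d a b.
have [p [q apq]] := fraction_ratio a; have [r [s brs]] := fraction_ratio b.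
rewrite (fracmod_scaleE _ _ brs) (fracmod_scaleE _ _ apq).
rewrite (@fracmod_scaleE _ (p * val s + r * val q) (mul_denom q s)).
  rewrite [RHS]fracmod_addE; apply: fracmod_mk_eq => /=.
  by rewrite !scalerDr !scalerA -scalerDl; congr (_ *: _) => /=; ring.
rewrite /= tofracD !tofracM -apq -brs mulrDl mulrA; congr (_ + _).
by rewrite -mulrA; congr (_ * _); rewrite mulrC.
Qed.

HB.instance Definition _ := GRing.Zmodule_isLmodule.Build K fracmod
  fracmod_scaleA fracmod_scale1 fracmod_scaleDr fracmod_scaleDl.

Definition to_fracmod (n : N) : fracmod := n /: one_denom.

(* The pure tensor a (x) n. *)
Definition frac_tensor (a : K) (n : N) : fracmod := a *: to_fracmod n.

Lemma frac_tensorE (a : K) (p : R) (q : denom) n :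
  a * (val q)%:F = p%:F -> frac_tensor a n = (p *: n) /: q.
Proof.
move=> apq; rewrite /frac_tensor /to_fracmod [LHS](fracmod_scaleE _ _ apq).
by apply: fracmod_mk_eq; rewrite /= mulr1.
Qed.

Lemma fracmod_mkE n d : n /: d = frac_tensor ((val d)%:F)^-1 n.
Proof.
rewrite (@frac_tensorE _ 1 d) ?scale1r //.
by rewrite mulVf ?tofrac_eq0 // (valP d).
Qed.

Lemma to_fracmodD n m : to_fracmod (n + m) = to_fracmod n + to_fracmod m.
Proof.
rewrite [RHS]fracmod_addE; apply: fracmod_mk_eq.
by rewrite /= !scale1r mulr1 scale1r.
Qed.

Lemma to_fracmodZ r n : to_fracmod (r *: n) = r%:F *: to_fracmod n.
Proof.
rewrite [RHS](@fracmod_scaleE _ r one_denom) ?mulr1 //.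
by apply: fracmod_mk_eq; rewrite /= mul1r.
Qed.

Lemma frac_tensorDl n : {morph frac_tensor^~ n : a b / a + b}.
Proof. by move=> a b; exact: scalerDl. Qed.

Lemma frac_tensorDr a : {morph frac_tensor a : n m / n + m}.
Proof. by move=> n m; rewrite /frac_tensor to_fracmodD scalerDr. Qed.

Lemma frac_tensor_balanced a r n :
  frac_tensor (a * r%:F) n = frac_tensor a (r *: n).
Proof. by rewrite /frac_tensor to_fracmodZ scalerA. Qed.

Lemma frac_tensorP (W : zmodType) (b : K -> N -> W) :
    (forall n, {morph b^~ n : a a' / a + a'}) ->
    (forall a, {morph b a : n m / n + m}) ->
    (forall a r n, b (a * r%:F) n = b a (r *: n)) ->
  exists2 g : {additive fracmod -> W}, forall a n, g (frac_tensor a n) = b a n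
    & forall h : {additive fracmod -> W},
        (forall a n, h (frac_tensor a n) = b a n) -> h =1 g.
Proof.
move=> bDl bDr bal.
pose g (x : fracmod) : W := b ((val (repr x).2)%:F)^-1 (repr x).1.
have dn0 (d : denom) : (val d)%:F != 0 :> K by rewrite tofrac_eq0 (valP d).
(* Over an abstract field, because [field] diverges on {fraction R}. *)
have divl (F : fieldType) (x y : F) : x != 0 -> y != 0 -> x^-1 = (x * y)^-1 * y.
  by move=> x0 y0; field; rewrite x0 y0.
have divr (F : fieldType) (x y : F) : x != 0 -> y != 0 -> y^-1 = (x * y)^-1 * x.
  by move=> x0 y0; field; rewrite x0 y0.
have gE n d : g (n /: d) = b ((val d)%:F)^-1 n.
  rewrite /g; have [u u0 eu] := repr_fracmod_mkP n d.
  move: (repr (n /: d)) eu => [n' d'] /= eu.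
  have u0' : u%:F != 0 :> K by rewrite tofrac_eq0.
  rewrite (divr _ (val d)%:F (val d')%:F) ?dn0 //.
  rewrite (divl _ (val d)%:F (val d')%:F) ?dn0 //.
  rewrite !bal (divl _ ((val d)%:F * (val d')%:F) u%:F) ?mulf_neq0 ?dn0 //.
  by rewrite !bal eu.
have gD : {morph g : x y / x + y}.
  elim/fracmod_ind=> n d; elim/fracmod_ind=> m e.
  rewrite [_ /: d + _]fracmod_addE !gE bDr -!bal /= tofracM.
  by rewrite -divl -?divr ?dn0.
have gB : zmod_morphism g.
  move=> x y; apply: (addIr (g y)).
  by rewrite -gD subrK addrNK.
pose mB := GRing.isZmodMorphism.Build _ _ g gB.
pose G : {additive fracmod -> W} := HB.pack g mB.
exists G => [a n|h hE]; last first.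
  by elim/fracmod_ind=> n d; rewrite {1}fracmod_mkE hE -gE.
have [p [q apq]] := fraction_ratio a.
rewrite (frac_tensorE _ apq) /= gE -bal -apq; congr (b _ _).
by rewrite mulrCA mulVf ?mulr1.
Qed.

End FracModule.

Definition torsionfree (R : idomainType) (N : lmodType R) : Prop :=
  injective (@to_fracmod R N).

Definition has_rank (R : idomainType) (N : lmodType R) (s : nat) : Prop :=
  exists f : {linear fracmod N -> 'rV[{fraction R}]_s}, bijective f.

(* Main.v *)
Require Import Defs.
From mathcomp Require Import all_boot all_order all_algebra.
From mathcomp Require Import perm.
From mathcomp Require Import boolp classical_sets.
From mathcomp Require Import ring.

(** The theorem compares torsion in N with minors of psi, through the primes p
    of height at most one. In a Noetherian normal domain these are exactly the
    primes for which p R_p is principal, that is, for which R_p is a field or a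
    discrete valuation ring. Instead of forming R_p, the predicate
    [locally_principal] asks for elements r of p and c outside p with
    c p contained in r R. That a prime of height at most one has this property,
    and that a prime of the form (a : b) has it, come from the classical
    dichotomy for x = b / a: either x p is contained in p, and then x is
    integral over R by the determinant trick, hence in R, or x p contains an
    element outside p ([prime_colon_locally_principal]). Conversely, Nakayama's
    lemma shows that nothing lies strictly between 0 and such a prime
    ([locally_principal_height_lt2]). Hence an ideal J of height at least two
    is contained in no proper ideal (a : b) with a nonzero: if J b lies in a R,
    then so does b
    ([height_ge2_colon]).

    Over the fraction field psi has rank k = beta0 - s ([rank_presentation]).

    For (a), a torsionfree N means that the column space L of psi contains
    every v with u v in L for some nonzero u. Over a discrete valuation ring
    N would then be free and some k-minor would be a unit. Concretely
    ([exists_minor_notin]): if all k-minors lay in a locally principal p, take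
    t < k such that some t-minor det B is outside p but every (t+1)-minor is
    in p.
    The Schur complement of B in psi has its entries in p, since they are
    bordered (t+1)-minors, so it can be divided by r after multiplication by c.
    The quotient still lies in L, and in the span of the Schur complement, so
    Nakayama's lemma makes the latter zero. Thus psi has rank t, a
    contradiction. So every prime containing the k-minors has height at least
    two.

    For (b), Cramer's rule shows that every k-minor kills the torsion of N
    ([minor_mul_saturation]), so the annihilator of a torsion element x
    contains the ideal J of k-minors. Lift x to m in M. If u x = 0 with
    u nonzero, then u m = phi w, and for r in J the element r m is in the image
    of phi as well; as phi is injective, r w is in u R^s. So J w_i lies in u R
    for each i, and since J has height at least two, w = u w'. As M is
    torsionfree, m = phi w' and x = 0. *)

Set Implicit Arguments.
Unset Strict Implicit.
Unset Printing Implicit Defensive.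

Import GRing.Theory.
Local Open Scope ring_scope.

(** * The determinant trick *)

Lemma mulmx_det_eq0 (R : idomainType) (m n : nat) (W : 'M[R]_(m, n))
    (A : 'M[R]_n) :
  W *m A = 0 -> \det A != 0 -> W = 0.
Proof.
move=> WA0 dA0; have : W *m A *m \adj A = 0 by rewrite WA0 mul0mx.
rewrite -mulmxA mul_mx_adj mul_mx_scalar => /matrixP dW0.
apply/matrixP=> i j; move: (dW0 i j); rewrite !mxE => /eqP.
by rewrite mulf_eq0 (negbTE dA0) => /eqP.
Qed.

(** The determinant is the value at r of a polynomial with constant term
    c ^ n. *)
Lemma det_scalar_sub_scale (R : comNzRingType) (n : nat) (c r : R)
    (Y : 'M[R]_n) :
  exists e : R, \det (c%:M - r *: Y) = c ^+ n + r * e.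
Proof.
pose D : {poly R} := \det ((c%:P)%:M - 'X *: map_mx polyC Y).
have DE x : D.[x] = \det (c%:M - x *: Y).
  rewrite /D -[LHS]/(horner_eval x _) -det_map_mx; congr (\det _).
  apply/matrixP=> i j; rewrite !mxE /= /horner_eval.
  by rewrite hornerD hornerN hornerMn hornerC hornerM hornerX hornerC.
rewrite -DE; have := DE 0; rewrite scale0r subr0 det_scalar => <-.
elim/poly_ind: D {DE} => [|D d _]; first by exists 0; rewrite !horner0 mulr0 addr0.
by exists D.[r]; rewrite !hornerMXaddC mulr0 add0r addrC mulrC.
Qed.

Lemma prime_idealX (R : comNzRingType) (p : set R) (c : R) (n : nat) :
  is_prime_ideal p -> p (c ^+ n) -> p c.
Proof.
move=> [_ p1 pM]; elim: n => [|n IHn]; first by rewrite expr0 => /p1.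
by rewrite exprS => /pM[].
Qed.

Lemma ideal_sum (R : comNzRingType) (I : set R) (J : finType) (F : J -> R) :
  is_ideal I -> (forall i, I (F i)) -> I (\sum_i F i).
Proof.
by move=> [I0 ID _] IF; apply: big_ind => // x y; apply: ID.
Qed.

(** Nakayama's lemma over R_p, for the module spanned by the columns of W:
    after multiplication by the unit c of R_p each column falls into r times
    their span. The determinant that annihilates W is congruent to c ^ n
    modulo r, hence nonzero. *)
Lemma nakayama_eq0 (R : idomainType) (p : set R) (c r : R) (m n : nat)
    (W : 'M[R]_(m, n)) (Y : 'M[R]_n) :
  is_prime_ideal p -> ~ p c -> p r -> c *: W = r *: (W *m Y) -> W = 0.
Proof.
move=> pp pc pr cW; have [[p0 pD pZ] _ _] := pp.
apply: (@mulmx_det_eq0 _ _ _ _ (c%:M - r *: Y)).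
  by rewrite mulmxBr mul_mx_scalar cW -scalemxAr subrr.
apply/eqP; have [e ->] := det_scalar_sub_scale c r Y => e0.
apply: pc; apply: (@prime_idealX _ _ _ n pp).
have -> : c ^+ n = (- e) * r by rewrite mulNr mulrC; apply/eqP; rewrite -addr_eq0 e0.
exact: pZ.
Qed.

(** * Noetherian rings *)

(** Otherwise dependent choice gives a strictly increasing chain of ideals,
    whose union is an ideal that is not finitely generated. *)
Lemma noetherian_max (R : comNzRingType) (F : set R -> Prop) (I0 : set R) :
  noetherian R -> (forall I, F I -> is_ideal I) -> F I0 ->
  exists I, [/\ F I, (I0 `<=` I)%classic
    & forall J, F J -> (I `<=` J)%classic -> (J `<=` I)%classic].
Proof.
move=> Rn Fid FI0; apply: contrapT => nomax.
pose X := {I : set R | F I /\ (I0 `<=` I)%classic}.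
have step (x : X) : {y : X | (sval x `<` sval y)%classic}.
  apply: cid; apply: contrapT => noy; apply: nomax.
  case: x noy => I [FI I0I] /= noy; exists I; split=> // J FJ IJ.
  apply: contrapT => JI; apply: noy.
  by exists (exist _ J (conj FJ (subset_trans I0I IJ))).
have [f [_ fS]] := dependent_choice step (exist _ I0 (conj FI0 (@subset_refl _ I0))).
have fid n : is_ideal (sval (f n)) by apply: Fid; case: (f n) => I [].
have fmono m n : (m <= n)%N -> (sval (f m) `<=` sval (f n))%classic.
  elim: n => [|n IHn]; first by rewrite leqn0 => /eqP->.
  rewrite leq_eqVlt => /orP[/eqP->//|/IHn fmn].
  by apply: subset_trans fmn _; apply: properW; exact: fS.
pose U : set R := fun x => exists n, sval (f n) x.
have Uid : is_ideal U.
  split; first by exists 0%N; case: (fid 0%N).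
  - move=> x y [m fx] [n fy]; exists (maxn m n); case: (fid (maxn m n)) => _ + _.
    by apply; [apply: fmono fx; exact: leq_maxl|apply: fmono fy; exact: leq_maxr].
  - by move=> a x [n fx]; exists n; case: (fid n) => _ _; apply.
have [s Us] := Rn U Uid.
have [n sn] : exists n, forall x, x \in s -> sval (f n) x.
  have : forall x, x \in s -> U x by move=> x xs; rewrite Us => J [_]; apply.
  elim: s {Us} => [|y s IHs] sU; first by exists 0%N.
  have [m fm] := sU y (mem_head _ _).
  have [|n fn] := IHs; first by move=> x xs; apply: sU; rewrite in_cons xs orbT.
  exists (maxn m n) => x; rewrite in_cons => /orP[/eqP->|/fn fx].
    by apply: fmono fm; exact: leq_maxl.
  by apply: fmono fx; exact: leq_maxr.
have [_ nsub] := fS n; apply: nsub => x fx.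
have : U x by exists n.+1.
by rewrite Us; apply: smallest_sub; [exact: fid|exact: sn].
Qed.

(** Coefficients are chosen for a whole row x of elements of I at once, the form
    in which the determinant trick consumes them. *)
Lemma noetherian_fg (R : comNzRingType) (I : set R) :
  noetherian R -> is_ideal I ->
  exists (n : nat) (g : 'rV[R]_n), (forall i, I (g 0 i)) /\
    forall m (x : 'rV[R]_m), (forall j, I (x 0 j)) -> exists Y, x = g *m Y.
Proof.
move=> Rn Iid; have [s Is] := Rn I Iid.
pose g : 'rV[R]_(size s) := \row_i s`_i.
have gI i : I (g 0 i).
  by rewrite mxE Is => J [_ sJ]; apply: sJ => /=; apply: mem_nth.
exists (size s), g; split=> // m x xI.
have gen : (I `<=` [set y | exists z : 'cV_(size s), y%:M = g *m z])%classic.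
  rewrite {1}Is; apply: smallest_sub; first split.
  - by exists 0; rewrite mulmx0 raddf0.
  - by move=> u v [zu eu] [zv ev]; exists (zu + zv); rewrite mulmxDr raddfD /= eu ev.
  - by move=> a u [z e]; exists (a *: z); rewrite -scalemxAr -e scale_scalar_mx.
  move=> y /= ys; have ilt : (index y s < size s)%N by rewrite index_mem.
  exists (delta_mx (Ordinal ilt) 0); rewrite -colE; apply/matrixP=> i j.
  by rewrite !ord1 !mxE /= nth_index.
pose z j := projT1 (cid (gen _ (xI j))).
exists (\matrix_(i, j) z j i 0); apply/rowP=> j.
have /matrixP/(_ 0 0) := projT2 (cid (gen _ (xI j))).
by rewrite !mxE /= mulr1n => ->; apply: eq_bigr => i _; rewrite !mxE.
Qed.

(** * Primes of height at most one in a normal domain *)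

Definition colon (R : comNzRingType) (a b : R) : set R :=
  fun r => exists d, r * b = a * d.

Lemma ideal_colon (R : comNzRingType) (a b : R) : is_ideal (colon a b).
Proof.
split; first by exists 0; rewrite mul0r mulr0.
- by move=> x y [d xd] [e ye]; exists (d + e); rewrite mulrDl xd ye mulrDr.
- by move=> c x [d xd]; exists (c * d); rewrite -mulrA xd mulrCA.
Qed.

(** The existence of an associated prime of R / aR that contains (a : b0) and
    survives in the localization of R at the multiplicative set S. Among the
    ideals C b = (a : b) S^-1 R, contracted to R, a maximal proper one is prime;
    clearing finitely many denominators exhibits it as a colon ideal (a : u b)
    of R itself. *)
Lemma exists_prime_colon (R : comNzRingType) (S : set R) (a b0 : R) :
  noetherian R -> S 1 -> (forall u v, S u -> S v -> S (u * v)) ->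
  (forall u, S u -> ~ colon a b0 u) ->
  exists b, [/\ is_prime_ideal (colon a b), (colon a b0 `<=` colon a b)%classic
    & forall u, S u -> ~ colon a b u].
Proof.
move=> Rn S1 SM b0S.
pose C b : set R := fun r => exists2 u, S u & colon a b (u * r).
have Cid b : is_ideal (C b).
  have [c0 cD cZ] := ideal_colon a b.
  split; first by exists 1; rewrite // mulr0.
  - move=> x y [u Su ux] [v Sv vy]; exists (u * v); first exact: SM.
    have -> : u * v * (x + y) = v * (u * x) + u * (v * y) by ring.
    by apply: cD; apply: cZ.
  - by move=> e x [u Su ux]; exists u; rewrite // mulrCA; apply: cZ.
pose F I := exists b, I = C b /\ forall u, S u -> ~ colon a b u.
have [] := @noetherian_max _ F (C b0) Rn; first by move=> I [b [-> _]].
  by exists b0.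
move=> I [[b [-> bS]] b0b Cmax].
have Cprime : is_prime_ideal (C b).
  split=> //; first by move=> [u Su]; rewrite mulr1; exact: bS.
  move=> x y [u Su [d xyd]]; case: (pselect (C b x)) => [|nCx]; first by left.
(* C (x * b) contains C b and is proper because x is not in C b, so the two
     are equal by maximality. *)
  right; apply: (Cmax (C (x * b))).
  - exists (x * b); split=> // v Sv [e ve]; apply: nCx.
    by exists v => //; exists e; rewrite -mulrA.
  - move=> z [v Sv [e ze]]; exists v => //; exists (x * e).
    by rewrite mulrCA ze mulrCA.
  - by exists u => //; exists d; rewrite -xyd; ring.
have [n [g [gC Cg]]] := noetherian_fg Rn (Cid b).
(* u is a common denominator for the finitely many generators of C b. *)
have [u Su ug] : exists2 u, S u & forall i, colon a b (u * g 0 i).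
  pose w i := projT1 (cid2 (gC i)).
  have Sw i : S (w i) by rewrite /w; case: cid2.
  have cw i : colon a b (w i * g 0 i) by rewrite /w; case: cid2.
  exists (\prod_i w i) => [|i]; first by apply: big_ind.
  rewrite (bigD1 i) //= mulrAC mulrC.
  by have [_ _ cZ] := ideal_colon a b; apply: cZ.
have CE : C b = colon a (u * b).
  apply/seteqP; split=> r.
    move=> Cr; have [|Y rgY] := Cg _ (r%:M : 'rV_1).
      by move=> j; rewrite ord1 mxE mulr1n.
    have /matrixP/(_ 0 0) := rgY; rewrite !mxE mulr1n => ->.
    apply: ideal_sum => [|i]; first exact: ideal_colon.
    have [d gd] := ug i; exists (Y i 0 * d).
    have -> : g 0 i * Y i 0 * (u * b) = Y i 0 * (u * g 0 i * b) by ring.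
    by rewrite gd mulrCA.
  by move=> [d rd]; exists u => //; exists d; rewrite -rd; ring.
exists (u * b); rewrite -CE; split=> //.
  by move=> r /= cr; apply: b0b; exists 1; rewrite ?mul1r.
by move=> v Sv [w Sw wv]; apply: (bS (w * v)) => //; exact: SM.
Qed.

(** For a prime q of a Noetherian domain this says that r generates q R_q, so
    that R_q is a field or a discrete valuation ring; c is a common denominator
    for the fractions t / r. The zero ideal qualifies with r = 0 and c = 1. *)
Definition locally_principal (R : comNzRingType) (q : set R) : Prop :=
  exists r c, [/\ q r, ~ q c & forall t, q t -> exists d, c * t = r * d].

(** By the determinant trick b / a is an eigenvalue of Y over the fraction
    field, so the characteristic polynomial of Y is an integral equation for
    it. *)
Lemma integral_ratio (R : idomainType) (a b : R) (n : nat) (g : 'rV[R]_n)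
    (Y : 'M[R]_n) :
  normal_domain R -> a != 0 -> g != 0 -> b *: g = a *: (g *m Y) ->
  exists d, b = a * d.
Proof.
move=> Rnormal a0 g0 bg.
have det0 : \det (b%:M - a *: Y) = 0.
  apply/eqP; apply: contraNT g0 => d0; apply/eqP; apply: mulmx_det_eq0 d0.
  by rewrite mulmxBr mul_mx_scalar bg -scalemxAr subrr.
pose K := {fraction R}; pose tf : {rmorphism R -> K} := @FracField.tofrac R.
have a0K : tf a != 0 by rewrite tofrac_eq0.
have [|d bd] := Rnormal (tf b / tf a).
  exists (char_poly Y); first exact: char_poly_monic.
  rewrite (map_char_poly tf) -eigenvalue_root_char.
  apply/eigenvalueP.
  have : \det ((tf b / tf a)%:M - map_mx tf Y) == 0.
    have := congr1 tf det0; rewrite -det_map_mx map_mxB map_mxZ map_scalar_mx.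
    have -> : (tf b)%:M = tf a *: (tf b / tf a)%:M :> 'M_n.
      by rewrite scale_scalar_mx mulrC divfK.
    rewrite rmorph0 -scalerBr detZ.
    by move=> /eqP; rewrite mulf_eq0 expf_eq0 (negbTE a0K) andbF.
  move=> /det0P[v v0 vM]; exists v => //; move: vM.
  by rewrite mulmxBr mul_mx_scalar => /eqP; rewrite subr_eq0 => /eqP->.
exists d; apply/eqP; rewrite -tofrac_eq tofracM -bd mulrC.
by rewrite divfK.
Qed.

(** Put x = b / a and q = (a : b), so that x q is contained in R. If x q were
    contained in q, then x would be integral over R, hence in R, and q would be
    the unit ideal. So c = x r is outside q for some generator r of q, and then
    c t = r (x t) for every t in q. *)
Lemma prime_colon_locally_principal (R : idomainType) (a b : R) :
  noetherian R -> normal_domain R -> a != 0 -> is_prime_ideal (colon a b) ->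
  locally_principal (colon a b).
Proof.
move=> Rn Rnormal a0 qp; have [qid q1 qM] := qp.
have [n [g [gq qg]]] := noetherian_fg Rn qid.
pose D : 'rV[R]_n := \row_i projT1 (cid (gq i)).
have DE i : g 0 i * b = a * D 0 i by rewrite mxE; case: cid.
case: (pselect (forall i, colon a b (D 0 i))) => [Dq|].
(* Here D = x g is again a row of elements of q. *)
  have [Y DY] := qg _ D Dq; exfalso; apply: q1; rewrite /colon.
  have [||d bd] := integral_ratio Rnormal a0 (g := g) (Y := Y) (b := b).
(* The generators do not all vanish, because a is in q. *)
  - have [|Z aZ] := qg _ (a%:M : 'rV_1).
      by move=> j; rewrite ord1 mxE mulr1n; exists b.
    apply: contraNneq a0 => g0; move: aZ; rewrite g0 mul0mx.
    by move/matrixP/(_ 0 0); rewrite !mxE mulr1n => ->.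
  - by rewrite -DY; apply/rowP => i; rewrite [LHS]mxE mulrC DE [RHS]mxE.
  - by exists d; rewrite mul1r.
move=> /existsNP[i nDi]; exists (g 0 i), (D 0 i); split=> // t [e te].
exists e; apply: (mulfI a0); rewrite mulrA -DE -mulrA [b * t]mulrC te; ring.
Qed.

Lemma prime_chain_le (R : comNzRingType) (m : nat) (P : nat -> set R) (i j : nat) :
  prime_chain m P -> (i <= j <= m)%N -> (P i `<=` P j)%classic.
Proof.
move=> [_ Plt]; elim: j => [|j IHj]; first by rewrite leqn0 => /andP[/eqP-> _] x.
case/andP; rewrite leq_eqVlt => /orP[/eqP-> _ x //|ij] jm.
apply: subset_trans (properW (Plt j jm)).
by apply: IHj; rewrite -ltnS ij ltnW.
Qed.

(** Let P be a prime strictly inside q. As c q lies in r R, the generator r is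
    not in P; dividing the inclusion of c P in r R by r gives c P inside r P,
    and Nakayama's lemma yields P = 0. *)
Lemma locally_principal_height_lt2 (R : idomainType) (q : set R) :
  noetherian R -> is_prime_ideal q -> locally_principal q ->
  ~ prime_height_ge q 2.
Proof.
move=> Rn qp [r [c [qr qc cq]]] [m [P [m2 Pch Pm]]].
have [Pp Plt] := Pch.
have [P0id _ _] : is_prime_ideal (P 0%N) by apply: Pp.
have [p1id p11 p1M] : is_prime_ideal (P 1%N) by apply: Pp; apply: ltnW.
have [_ nP10] := Plt 0%N (ltnW m2).
have P1q : (P 1%N `<=` q)%classic.
  by rewrite -Pm; apply: prime_chain_le Pch _; rewrite leqnn ltnW.
have nqP1 : ~ (q `<=` P 1%N)%classic.
  have [_ n21] := Plt 1%N m2; apply: contra_not n21 => /(subset_trans _); apply.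
  by rewrite -Pm; apply: prime_chain_le Pch _; rewrite m2 leqnn.
have [_ _ p1Z] := p1id.
have [g [G [gP Pg]]] := noetherian_fg Rn p1id.
have nP1c : ~ P 1%N c by move=> /P1q.
have nP1r : ~ P 1%N r.
  move=> P1r; apply: nqP1 => t qt; have [d ct] := cq t qt.
  have /p1M[] // : P 1%N (c * t) by rewrite ct mulrC; apply: p1Z.
pose D : 'rV[R]_g := \row_i projT1 (cid (cq _ (P1q _ (gP i)))).
have DE i : c * G 0 i = r * D 0 i by rewrite mxE; case: cid.
have [|Y DY] := Pg _ D.
  move=> i; have /p1M[] // : P 1%N (r * D 0 i).
  by rewrite -DE; apply: p1Z; apply: gP.
have G0 : G = 0.
  apply: (nakayama_eq0 qp qc qr (Y := Y)).
  by rewrite -DY; apply/rowP=> i; rewrite [LHS]mxE DE [RHS]mxE.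
apply: nP10 => y P1y; have [|Z yZ] := Pg _ (y%:M : 'rV_1).
  by move=> j; rewrite ord1 mxE mulr1n.
by move: yZ; rewrite G0 mul0mx => /matrixP/(_ 0 0); rewrite !mxE mulr1n => ->; case: P0id.
Qed.

(** If b were not in aR, then J would be contained in a prime ideal (a : b'),
    which has height at most one. *)
Lemma height_ge2_colon (R : idomainType) (J : set R) (a b : R) :
  noetherian R -> normal_domain R -> height_ge J 2 -> a != 0 ->
  (J `<=` colon a b)%classic -> exists d, b = a * d.
Proof.
move=> Rn Rnormal Jht a0 Jab; apply: contrapT => nab.
have [||u -> [d]|b' [qp abq _]] := @exists_prime_colon _ [set 1]%classic a b Rn.
- by [].
- by move=> u v -> ->; rewrite mulr1.
- by rewrite mul1r => bd; apply: nab; exists d.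
apply: (locally_principal_height_lt2 Rn qp).
  exact: prime_colon_locally_principal.
exact: Jht _ qp (subset_trans Jab abq).
Qed.

(** For a nonzero a in p, the associated primes of R / aR that survive in R_p
    provide a nonzero prime (a : b) inside p, which must be p itself. *)
Lemma locally_principal_of_height_lt2 (R : idomainType) (p : set R) :
  noetherian R -> normal_domain R -> is_prime_ideal p ->
  ~ prime_height_ge p 2 -> locally_principal p.
Proof.
move=> Rn Rnormal pp pht; have [[p0 pD pZ] p1 pM] := pp.
case: (pselect (exists2 a, p a & a != 0)) => [[a pa a0]|p00]; last first.
  exists 0, 1; split=> // t pt; exists 0; rewrite mul1r mulr0.
  by apply: contrapT => /eqP t0; apply: p00; exists t.
have [||u pu [d]|b [qp _ pq]] := @exists_prime_colon _ (~` p)%classic a 1 Rn.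
- exact: p1.
- by move=> u v pu pv /pM[].
- by rewrite mulr1 => ud; apply: pu; rewrite ud mulrC; apply: pZ.
have qsubp : (colon a b `<=` p)%classic by move=> t qt; apply: contrapT => /pq.
case: (pselect (p `<=` colon a b)%classic) => [psubq|npq].
  have -> : p = colon a b by apply/seteqP.
  exact: prime_colon_locally_principal.
exfalso; apply: pht.
exists 2%N, (fun i => if i is i'.+1 then (if i' is 0 then colon a b else p)
                      else [set 0]%classic).
split=> //; split=> [[|[|i]]|[|[|i]]] //= _.
- split; first split=> //=.
  + by move=> x y -> ->; rewrite addr0.
  + by move=> e x ->; rewrite mulr0.
  + by apply/eqP; rewrite oner_eq0.
  + by move=> x y /eqP; rewrite mulf_eq0 => /orP[]/eqP; [left|right].
- split; first by move=> x ->; case: qp => -[].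
  move=> /(_ a) /=; move/eqP: a0; apply: contra_not; apply.
  by exists b; rewrite mulrC.
Qed.

(** * Minors *)

Lemma sort_perm (l k : nat) (h : 'I_k -> 'I_l) : injective h ->
  exists s : 'S_k, {homo (fun i => h (s i)) : i j / (i < j)%N}.
Proof.
move=> hinj; pose t := [tuple h i | i < k].
pose st := sort (fun x y : 'I_l => (x <= y)%N) t.
have /tuple_permP[s stE] : perm_eq st t by rewrite perm_sort.
exists s => i j ij.
have sz : size st = k by rewrite size_sort size_tuple.
have st_nth (i' : 'I_k) : nth (h i) st i' = h (s i').
  by rewrite stE (nth_map i') ?size_enum_ord // nth_ord_enum tnth_mktuple.
have st_uniq : uniq st.
  by rewrite sort_uniq map_inj_uniq ?enum_uniq.
have : sorted ltn (map val st).
  rewrite ltn_sorted_uniq_leq map_inj_uniq ?st_uniq; last exact: val_inj.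
  by rewrite sorted_map; apply: sort_sorted => x y; apply: leq_total.
move=> /(sorted_ltn_nth ltn_trans (nat_of_ord (h i))) /(_ i j).
rewrite !inE size_map sz !ltn_ord => /(_ isT isT ij).
by rewrite !(nth_map (h i)) ?sz // !st_nth.
Qed.

(** Row and column selections that are not increasing give no new minors up to
    sign: sort them, or get 0 from a repetition. *)
Lemma minor_mem_ideal (R : comNzRingType) (m n k : nat) (A : 'M[R]_(m, n))
    (I : set R) (f : 'I_k -> 'I_m) (g : 'I_k -> 'I_n) :
  is_ideal I -> (forall x, is_minor k A x -> I x) -> I (\det (mxsub f g A)).
Proof.
move=> [I0 _ IZ] Iminor.
have alt (l l' : nat) (h : 'I_k -> 'I_l) (h' : 'I_k -> 'I_l') (B : 'M[R]_(l, l')) :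
    ~ injective h -> \det (mxsub h h' B) = 0.
  move=> /existsNP[i /existsNP[j /not_implyP[hij /eqP ij]]].
  apply: (determinant_alternate ij) => l0.
  by rewrite !mxE hij.
case: (pselect (injective f)) => [finj|/alt->//].
case: (pselect (injective g)) => [ginj|]; last first.
  by move=> /alt gdet; rewrite -det_tr trmx_mxsub gdet.
have [s fs] := sort_perm finj; have [t gt] := sort_perm ginj.
have -> : mxsub f g A = row_perm s^-1 (col_perm t^-1 (mxsub (f \o s) (g \o t) A)).
  by apply/matrixP=> i j; rewrite !mxE /= !permKV.
rewrite row_permE col_permE !det_mulmx !det_perm mulrA mulrAC.
by apply: IZ; apply: Iminor; exists (f \o s), (g \o t).
Qed.

(** * The rank of a presentation matrix *)

Section Presentation.
Variables (R : idomainType) (N : lmodType R).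
Local Notation K := {fraction R}.
Local Notation tf := (@FracField.tofrac R).

Lemma to_fracmod_eq (x y : N) :
  to_fracmod x = to_fracmod y <-> exists2 u : R, u != 0 & u *: x = u *: y.
Proof.
rewrite /to_fracmod; split=> [/fracmod_mkP[u u0]|[u u0 e]].
  by rewrite /= !scale1r; exists u.
by apply/fracmod_mkP; exists u; rewrite //= !scale1r.
Qed.

Lemma torsionfreeP :
  torsionfree N <-> forall (u : R) (x : N), u != 0 -> u *: x = 0 -> x = 0.
Proof.
split=> [tfN u x u0 ux|tfN x y /to_fracmod_eq[u u0 uxy]].
  by apply: tfN; apply/to_fracmod_eq; exists u; rewrite ?scaler0.
by apply/eqP; rewrite -subr_eq0; apply/eqP/(tfN u); rewrite // scalerBr uxy subrr.
Qed.

Lemma common_denominator (n : nat) (v : 'rV[K]_n) :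
  exists2 d : R, d != 0 & exists w : 'rV[R]_n, map_mx tf w = tf d *: v.
Proof.
pose q i := projT1 (cid (projT2 (cid (fraction_ratio (v 0 i))))).
have qP i : exists p : R, v 0 i * tf (val (q i)) = tf p.
  by rewrite /q; case: cid => /= p [d e]; case: cid => d' /= e'; exists p.
exists (\prod_i val (q i)).
  by apply/prodf_neq0 => i _; apply: valP (q i).
exists (\row_i (projT1 (cid (qP i)) * \prod_(j | j != i) val (q j))).
apply/rowP=> i; rewrite !mxE; case: cid => p /= e.
by rewrite [in RHS](bigD1 i) //= !tofracM -e; ring.
Qed.

(** Tensoring the presentation with the fraction field K leaves an exact
    sequence K^beta1 -> K^beta0 -> K^s -> 0. The matrix A of the second map acts
    on row vectors, so exactness says that the kernel of A is the row space of
    the transpose of psi. *)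
Lemma rank_presentation (s beta0 beta1 : nat) (psi : 'M[R]_(beta0, beta1))
    (pi : {linear 'cV[R]_beta0 -> N}) :
  has_rank N s -> exact_at (fun v : 'cV[R]_beta1 => psi *m v) pi ->
  is_surjective pi ->
  (s <= beta0)%N /\ \rank (map_mx tf psi) = (beta0 - s)%N.
Proof.
move=> [f [f' fK f'K]] ex surj.
pose A : 'M[K]_(beta0, s) := \matrix_i f (to_fracmod (pi (delta_mx i 0))).
have AE (w : 'rV[R]_beta0) : map_mx tf w *m A = f (to_fracmod (pi w^T)).
  have -> : w^T = \sum_i w 0 i *: delta_mx i 0.
    by rewrite [LHS]matrix_sum_delta; apply: eq_bigr => i _; rewrite big_ord1 mxE.
  rewrite mulmx_sum_row.
  pose F (x : 'cV[R]_beta0) := f (to_fracmod (pi x)).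
  have F0 : F 0 = 0.
    by rewrite /F linear0; exact: linear0.
  have FD : {morph F : x y / x + y >-> x + y}.
    by move=> x y; rewrite /F linearD to_fracmodD linearD.
  rewrite -/(F _) (big_morph F FD F0); apply: eq_bigr => i _.
  by rewrite /F linearZ to_fracmodZ linearZ /= rowK mxE.
have Afull : row_full A.
  rewrite -sub1mx; apply/row_subP=> j.
  rewrite -(f'K (row j 1%:M)); elim/fracmod_ind: (f' _) => x d.
  have [v <-] := surj x.
  rewrite fracmod_mkE /frac_tensor linearZ /= scalemx_sub //.
  by rewrite -[v]trmxK -AE submxMl.
have Aker : (map_mx tf psi)^T *m A = 0.
  apply/row_matrixP=> j; rewrite row_mul row0 map_trmx -map_row AE.
  suff -> : pi (row j psi^T)^T = 0 by exact: linear0.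
  by apply/ex; exists (delta_mx j 0); rewrite -colE tr_row trmxK.
have kerA : (kermx A <= (map_mx tf psi)^T)%MS.
  apply/row_subP=> i; have := mulmx_ker A => /(congr1 (row i)).
  rewrite row_mul row0; move: (row i _) => v vA.
  have [d d0 [w wE]] := common_denominator v.
  have : f (to_fracmod (pi w^T)) = 0 by rewrite -AE wE -scalemxAl vA scaler0.
  rewrite -[0](linear0 f) => /(can_inj fK) /to_fracmod_eq[u u0].
  rewrite scaler0 -linearZ => /ex[y yE].
  have -> : v = (tf (u * d))^-1 *: (map_mx tf (u *: w)).
    rewrite map_mxZ wE !scalerA -tofracM mulVf ?scale1r //.
    by rewrite tofrac_eq0 mulf_neq0.
  apply: scalemx_sub; rewrite map_trmx -[u *: w]trmxK [(u *: w)^T]linearZ /= -yE.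
  by rewrite trmx_mul map_mxM submxMl.
have rA : \rank A = s by apply/eqP.
have r_psi : \rank (map_mx tf psi) = (beta0 - s)%N.
  rewrite -mxrank_tr -{1}rA -mxrank_ker; apply/eqP; rewrite eqn_leq.
  by rewrite !mxrankS //; apply/sub_kermxP.
by rewrite -{1}rA rank_leq_row.
Qed.

End Presentation.

(** * Minors of maximal size and torsion *)

(** Cramer's rule for the chosen rows and columns produces A z agreeing with
    det B *: v on the rows f. The difference w is in the column space of A over
    the fraction field, and when det B is nonzero the rows f span the row space
    of A there, so that w is determined by its entries in these rows. *)
Lemma minor_mul_saturation (R : idomainType) (m n k : nat) (A : 'M[R]_(m, n))
    (f : 'I_k -> 'I_m) (g : 'I_k -> 'I_n) (u : R) (v : 'cV[R]_m) (y : 'cV[R]_n) :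
  \rank (map_mx (@FracField.tofrac R) A) = k ->
  u != 0 -> u *: v = A *m y -> exists z, \det (mxsub f g A) *: v = A *m z.
Proof.
move=> rA u0 uv; set B := mxsub f g A.
have [->|dB0] := eqVneq (\det B) 0; first by exists 0; rewrite scale0r mulmx0.
pose tf : {rmorphism R -> {fraction R}} := @FracField.tofrac R.
rewrite -[@FracField.tofrac R]/(tf : _ -> _) in rA.
have rowA : (map_mx tf A <= rowsub f (map_mx tf A))%MS.
  have sub : (rowsub f (map_mx tf A) <= map_mx tf A)%MS by rewrite rowsubE submxMl.
  rewrite -(mxrank_leqif_sup sub) eqn_leq mxrankS //= rA.
  have rB : \rank (map_mx tf B) = k.
    by rewrite mxrank_unit // unitmxE det_map_mx unitfE tofrac_eq0.
  rewrite -{1}rB map_mxsub.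
  have -> : mxsub f g (map_mx tf A) = rowsub f (map_mx tf A) *m colsub g 1%:M.
    by rewrite -mxsub_mul mulmx1.
  exact: mxrankM_maxl.
have /submxP[X AX] := rowA.
pose z := colsub g 1%:M *m (\adj B *m rowsub f v).
exists z; apply/eqP; rewrite -subr_eq0; apply/eqP; set w := _ - _.
have fw : rowsub f w = 0.
  have -> : rowsub f w = \det B *: rowsub f v - rowsub f (A *m z).
    by apply/matrixP=> i j; rewrite !mxE.
  rewrite -mul_rowsub_mx /z !mulmxA -mxsub_mul mulmx1 mul_mx_adj.
  by rewrite mul_scalar_mx subrr.
have uw : u *: w = A *m (\det B *: y - u *: z).
  by rewrite scalerBr scalerA mulrC -scalerA uv mulmxBr -!scalemxAr.
have : map_mx tf (u *: w) = 0.
  rewrite uw map_mxM AX -mulmxA mul_rowsub_mx -map_mxM -uw -map_mxsub.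
  have -> : rowsub f (u *: w) = u *: rowsub f w by apply/matrixP=> i j; rewrite !mxE.
  by rewrite fw scaler0 map_mx0 mulmx0.
move=> uw0; apply/matrixP=> i j; move/matrixP/(_ i j): uw0; rewrite !mxE => /eqP.
by rewrite tofrac_eq0 mulf_eq0 (negbTE u0) => /eqP.
Qed.

Lemma det_bordered (R : idomainType) (t : nat) (B : 'M[R]_t) (c : 'cV[R]_t)
    (b : 'rV[R]_t) (d : 'M[R]_1) :
  \det B != 0 ->
  \det (block_mx B c b d) = (\det B *: d - b *m \adj B *m c) 0 0.
Proof.
move=> dB0; set W := _ - _; apply: (mulfI dB0).
have E : block_mx B c b d *m block_mx 1%:M (- (\adj B *m c)) 0 (\det B)%:M
    = block_mx B 0 b W.
  rewrite mulmx_block !mulmx1 !mulmx0 !addr0 !mulmxN !mul_mx_scalar !mulmxA.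
  by rewrite mul_mx_adj mul_scalar_mx addNr addrC.
have := congr1 determinant E; rewrite det_mulmx det_ublock det_lblock det1 mul1r.
by rewrite det_scalar1 [\det W]det_mx11 mulrC.
Qed.

(** The column space of A is saturated, that is, the cokernel of A is
    torsionfree. Over R_p that cokernel is free, so a minor of size the rank of
    A is a unit. If B has size t and determinant outside p while all
    (t+1)-minors are in p, the Schur complement W of B has entries in p. After
    multiplying by c and dividing by r, its columns stay in the saturated column
    space and vanish on the rows of B, so det B times them are again
    combinations of the columns of W. Nakayama's lemma gives W = 0, whence A has
    rank at most t. *)
Lemma exists_minor_notin (R : idomainType) (m n k : nat) (A : 'M[R]_(m, n))
    (p : set R) :
  is_prime_ideal p -> locally_principal p ->
  (forall (u : R) (v : 'cV[R]_m) (y : 'cV[R]_n),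
     u != 0 -> u *: v = A *m y -> exists z, v = A *m z) ->
  \rank (map_mx (@FracField.tofrac R) A) = k ->
  exists (f : 'I_k -> 'I_m) (g : 'I_k -> 'I_n), ~ p (\det (mxsub f g A)).
Proof.
move=> pp [r [c [pr pc cp]]] Asat rA; have [[p0 pD pZ] p1 pM] := pp.
pose Q j := `[< forall (f : 'I_j -> 'I_m) (g : 'I_j -> 'I_n), p (\det (mxsub f g A)) >].
apply: contrapT => none.
have Qk : Q k.
  apply/asboolP=> f g; apply: contrapT => fg; apply: none.
  by exists f, g.
have exQ : exists j, Q j by exists k.
case: (ex_minnP exQ) => -[|t] /asboolP Qt tmin.
  have nof (l : nat) : 'I_0 -> 'I_l by case.
  by have := Qt (nof m) (nof n); rewrite det_mx00.
have /asboolP/existsNP[f /existsNP[g pB]] : ~~ Q t.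
  by apply/negP => /tmin; rewrite ltnn.
have tk : (t < k)%N := tmin _ Qk.
set B := mxsub f g A in pB.
have dB0 : \det B != 0 by apply: contra_not_neq pB => ->.
(* The Schur complement of B, cleared of denominators: its entries are the
   minors of A obtained from B by adding one row and one column. *)
pose W := \det B *: A - colsub g A *m \adj B *m rowsub f A.
have pW i j : p (W i j).
  pose f' (x : 'I_(t + 1)) := if split x is inl x' then f x' else i.
  pose g' (x : 'I_(t + 1)) := if split x is inl x' then g x' else j.
  have -> : W i j = \det (mxsub f' g' A).
    have -> : mxsub f' g' A = block_mx B (rowsub f (col j A))
        (colsub g (row i A)) (row i (col j A)).
      apply/matrixP=> x y; rewrite !mxE /f' /g'.
      by case: (split x) => x'; rewrite !mxE; case: (split y) => y'; rewrite !mxE.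
    rewrite det_bordered // /W.
    have -> : colsub g (row i A) *m \adj B *m rowsub f (col j A) =
        row i (col j (colsub g A *m \adj B *m rowsub f A)).
      have -> : colsub g (row i A) = row i (colsub g A).
        by apply/matrixP=> x y; rewrite !mxE.
      have -> : rowsub f (col j A) = col j (rowsub f A).
        by apply/matrixP=> x y; rewrite !mxE.
      by rewrite -row_mul !colE !row_mul !mulmxA.
    by rewrite !mxE.
  by move: f' g'; rewrite addn1; apply: Qt.
have WE : W = A *m ((\det B)%:M - colsub g 1%:M *m \adj B *m rowsub f A).
  by rewrite mulmxBr mul_mx_scalar !mulmxA mulmx_colsub mulmx1.
have fW : rowsub f W = 0.
  have -> : rowsub f W = \det B *: rowsub f A
      - rowsub f (colsub g A *m \adj B *m rowsub f A).
    by apply/matrixP=> i j; rewrite !mxE.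
  rewrite -!mul_rowsub_mx.
  have -> : rowsub f (colsub g A) = B by apply/matrixP=> i j; rewrite !mxE.
  by rewrite mul_mx_adj mul_scalar_mx subrr.
have W0 : W = 0.
  have [r0|r0] := eqVneq r 0.
    (* The prime p is then zero, and W has its entries in p. *)
    apply/matrixP=> i j; have [d /eqP] := cp _ (pW i j).
    rewrite r0 mul0r mulf_eq0 => /orP[/eqP c0|/eqP->]; last by rewrite mxE.
    by case: pc; rewrite c0.
  pose V : 'M[R]_(m, n) := \matrix_(i, j) projT1 (cid (cp _ (pW i j))).
  have VE : c *: W = r *: V.
    by apply/matrixP=> i j; rewrite !mxE; case: cid => d /= <-; rewrite /W !mxE.
  clearbody V; have [Y VY] : exists Y, V = A *m Y.
    have Vcol j : exists z, col j V = A *m z.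
      have [X WX] : exists X, W = A *m X by eexists; exact: WE.
      apply: (Asat r _ (c *: X *m delta_mx j 0)) => //.
      by rewrite colE mulmxA -scalemxAr -WX VE scalemxAl.
    exists (\matrix_(i, j) projT1 (cid (Vcol j)) i 0).
    apply/matrixP=> i j; rewrite [RHS]mxE; under eq_bigr do rewrite mxE.
    case: cid => z /= /matrixP/(_ i 0).
    by rewrite !mxE => ->.
  have fV : rowsub f V = 0.
    apply/matrixP=> i j; move/matrixP/(_ (f i) j): VE; move/matrixP/(_ i j): fW.
    by rewrite !mxE => -> /esym/eqP; rewrite mulr0 mulf_eq0 (negbTE r0) => /eqP ->.
(* The component of A *m Y along the columns g is determined by its entries in
     the rows f, which are zero. *)
  have dV : \det B *: V = W *m Y.
    rewrite /W mulmxBl -scalemxAl -VY -!mulmxA mul_rowsub_mx -VY fV.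
    by rewrite !mulmx0 subr0.
  apply: (nakayama_eq0 pp _ pr (c := \det B * c) (Y := Y)).
    by case/pM.
  by rewrite -scalerA VE scalerA mulrC -scalerA dV.
move: tk; rewrite ltnNge -rA => /negP; apply.
have -> : map_mx (@FracField.tofrac R) A = (FracField.tofrac (\det B))^-1 *:
    (map_mx (@FracField.tofrac R) (colsub g A)
       *m map_mx (@FracField.tofrac R) (\adj B *m rowsub f A)).
  rewrite -map_mxM mulmxA.
  move/eqP: W0; rewrite subr_eq0 => /eqP<-.
  by rewrite map_mxZ scalerA mulVf ?scale1r ?tofrac_eq0.
by rewrite scalemxAl mulmx_max_rank.
Qed.

(** * Torsionfreeness and the height of the ideal of minors *)

Theorem theorem4p5 (R : idomainType) (N : lmodType R) (s beta0 beta1 : nat)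
    (psi : 'M[R]_(beta0, beta1)) (pi : {linear 'cV[R]_beta0 -> N})
    (Rnoeth : noetherian R) (Rnormal : normal_domain R) (Rdim : dim_ge R 2)
    (Nrank : has_rank N s)
    (psi_pi_exact : exact_at (fun v : 'cV[R]_beta1 => psi *m v) pi)
    (pi_surj : is_surjective pi) :
  (torsionfree N -> height_ge (minor_ideal (beta0%:Z - s%:Z) psi) 2)
  /\
  ((exists (M : lmodType R) (phi : {linear 'cV[R]_s -> M})
        (q : {linear M -> N}),
      [/\ injective phi, exact_at phi q, is_surjective q,
          torsionfree M & finite_pdim M]) ->
   height_ge (minor_ideal (beta0%:Z - s%:Z) psi) 2 -> torsionfree N).
Proof.
have [s_le rpsi] := rank_presentation Nrank psi_pi_exact pi_surj.
rewrite subzn //=; split=> [/torsionfreeP tfN p pp Ip|].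
  apply: contrapT => /(locally_principal_of_height_lt2 Rnoeth Rnormal pp) plp.
  have [|f [g]] := exists_minor_notin pp plp _ rpsi.
    move=> u v y u0 uv; have /psi_pi_exact[z <-] : pi v = 0; last by exists z.
    by apply: (tfN u); rewrite // -linearZ; apply/psi_pi_exact; exists y.
  apply; apply: minor_mem_ideal => [|x xm]; first by case: pp.
  by apply: Ip => J [_]; apply.
move=> [M [phi [q [phi_inj ex q_surj /torsionfreeP tfM _]]]] Jht.
apply/torsionfreeP => u x u0 ux.
have [m mx] := q_surj x.
have /ex[w wE] : q (u *: m) = 0 by rewrite linearZ /= mx ux.
have Jw i r : minor_ideal (Posz (beta0 - s)%N) psi r -> colon u (w i 0) r.
  have ann : is_ideal [set r | r *: x = 0]%classic.
    split=> [|a b /= ax bx|a b /= bx]; first by rewrite /= scale0r.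
      by rewrite scalerDl ax bx addr0.
    by rewrite -scalerA bx scaler0.
  move=> /(smallest_sub ann) rx; have {rx} : r *: x = 0.
    apply: rx => _ [f [g [_ _ ->]]] /=.
    have [v vx] := pi_surj x.
    have [y vy] : exists y, psi *m y = u *: v.
      by apply/psi_pi_exact; rewrite linearZ /= vx.
    have [z dv] := minor_mul_saturation f g rpsi u0 (esym vy).
    by rewrite -vx -linearZ; apply/psi_pi_exact; exists z.
  rewrite -mx -linearZ => /ex[y yE].
  have /phi_inj/matrixP/(_ i 0) : phi (u *: y) = phi (r *: w).
    by rewrite !linearZ /= yE wE !scalerA mulrC.
  by rewrite !mxE => e; exists (y i 0).
pose w' : 'cV[R]_s := \col_i projT1 (cid (height_ge2_colon Rnoeth Rnormal Jht u0 (Jw i))).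
have ww' : w = u *: w'.
  by apply/colP=> i; rewrite !mxE; case: cid.
have mw' : m = phi w'.
  apply/eqP; rewrite -subr_eq0; apply/eqP; apply: (tfM u) => //.
  by rewrite scalerBr -wE ww' linearZ subrr.
by rewrite -mx mw'; apply/ex; exists w'.
Qed.
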